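(* As formal power series in $q$ (equivalently, for all complex $q$ with $|q|<1$), $$\sum_{n,r\ge 0} \frac{q^{n^2+2nr+3r^2}\,(-q;q^2)_{n+r}}{(q^2;q^2)_n\,(q^2;q^2)_r\,(q^2;q^4)_r} = \frac{(q^{16},q^{20},q^{36};q^{36})_\infty\,(q^2;q^4)_\infty}{(q;q)_\infty}.$$
   Context: Notation: $(a;q)_m=\prod_{j=0}^{m-1}(1-aq^j)$ for integers $m\ge 0$, $(a;q)_\infty=\prod_{j=0}^{\infty}(1-aq^j)$, and $(a_1,\dots,a_s;q)_\infty=(a_1;q)_\infty\cdots(a_s;q)_\infty$; the base may be replaced by any power of $q$ (e.g. $(a;q^4)_m=\prod_{j=0}^{m-1}(1-aq^{4j})$). *)

(* Defs.v *)
From HB Require Import structures.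
From mathcomp Require Import all_boot all_algebra.
From mathcomp Require Import boolp classical_sets.
From mathcomp Require Import zify.

Set Implicit Arguments.
Unset Strict Implicit.
Unset Printing Implicit Defensive.

Import GRing.Theory.
Local Open Scope ring_scope.

(* Formal power series in one indeterminate. They are wrapped in a record       *)
(* because nat -> R already carries the pointwise ring structure.               *)
Record fps (R : Type) := Fps { fps_coef : nat -> R }.

HB.instance Definition _ (R : Type) := gen_eqMixin (fps R).
HB.instance Definition _ (R : Type) := gen_choiceMixin (fps R).

Lemma fpsP (R : Type) (f g : fps R) :
  (forall k, fps_coef f k = fps_coef g k) -> f = g.
Proof. by case: f g => [f] [g] /= fg; congr Fps; apply: funext. Qed.

Section FpsZmodule.
Variable R : zmodType.
Implicit Types f g : fps R.

Definition fps_zero : fps R := Fps (fun=> 0).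
Definition fps_opp f : fps R := Fps (fun k => - fps_coef f k).
Definition fps_add f g : fps R := Fps (fun k => fps_coef f k + fps_coef g k).

Fact fps_addA : associative fps_add.
Proof. by move=> f g h; apply: fpsP => k /=; rewrite addrA. Qed.
Fact fps_addC : commutative fps_add.
Proof. by move=> f g; apply: fpsP => k /=; rewrite addrC. Qed.
Fact fps_add0 : left_id fps_zero fps_add.
Proof. by move=> f; apply: fpsP => k /=; rewrite add0r. Qed.
Fact fps_addN : left_inverse fps_zero fps_opp fps_add.
Proof. by move=> f; apply: fpsP => k /=; rewrite addNr. Qed.

HB.instance Definition _ :=
  GRing.isZmodule.Build (fps R) fps_addA fps_addC fps_add0 fps_addN.

Lemma fps_coef0 k : fps_coef (0 : fps R) k = 0. Proof. by []. Qed.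
Lemma fps_coefN f k : fps_coef (- f) k = - fps_coef f k. Proof. by []. Qed.
Lemma fps_coefD f g k : fps_coef (f + g) k = fps_coef f k + fps_coef g k.
Proof. by []. Qed.

End FpsZmodule.

Section FpsComRing.
Variable R : comNzRingType.
Implicit Types f g h : fps R.

Definition fps_one : fps R := Fps (fun k => (k == 0)%:R).
Definition fps_mul f g : fps R :=
  Fps (fun k => \sum_(i < k.+1) fps_coef f i * fps_coef g (k - i)%N).

Definition fps_trunc n f : {poly R} := \poly_(i < n) fps_coef f i.

Fact coef_fps_trunc n f k : (k < n)%N -> (fps_trunc n f)`_k = fps_coef f k.
Proof. by move=> kn; rewrite coef_poly kn. Qed.

Fact fps_mul_coef n f g k : (k < n)%N ->
  fps_coef (fps_mul f g) k = (fps_trunc n f * fps_trunc n g)`_k.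
Proof.
move=> kn; rewrite coefM /=; apply: eq_bigr => i _.
have ik : (i <= k)%N by rewrite -ltnS.
by rewrite !coef_fps_trunc // ?(leq_ltn_trans _ kn) // leq_subr.
Qed.

Fact fps_mulC : commutative fps_mul.
Proof.
by move=> f g; apply: fpsP => k; rewrite !(@fps_mul_coef k.+1) // mulrC.
Qed.

Fact fps_mulA : associative fps_mul.
Proof.
move=> f g h; apply: fpsP => k.
transitivity (fps_trunc k.+1 f * (fps_trunc k.+1 g * fps_trunc k.+1 h))`_k.
  rewrite (@fps_mul_coef k.+1) // !coefM; apply: eq_bigr => i _; congr (_ * _).
  rewrite coef_fps_trunc; last by rewrite ltnS leq_subr.
  by rewrite (@fps_mul_coef k.+1) // ltnS leq_subr.
rewrite mulrA (@fps_mul_coef k.+1) // !coefM; apply: eq_bigr => i _.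
by congr (_ * _); rewrite coef_fps_trunc // (@fps_mul_coef k.+1).
Qed.

Fact fps_mul1 : left_id fps_one fps_mul.
Proof.
move=> f; apply: fpsP => k /=.
rewrite big_ord_recl /= subn0 mul1r big1 ?addr0 // => i _.
by rewrite mul0r.
Qed.

Fact fps_mulD : left_distributive fps_mul +%R.
Proof.
move=> f g h; apply: fpsP => k; rewrite fps_coefD /= -big_split /=.
by apply: eq_bigr => i _; rewrite mulrDl.
Qed.

Fact fps_one_neq0 : fps_one != 0.
Proof.
apply/eqP => /(congr1 (fun f => fps_coef f 0)) /= /eqP.
by rewrite oner_eq0.
Qed.

HB.instance Definition _ := GRing.Zmodule_isComNzRing.Build (fps R)
  fps_mulA fps_mulC fps_mul1 fps_mulD fps_one_neq0.

Lemma fps_coef1 k : fps_coef (1 : fps R) k = (k == 0)%:R. Proof. by []. Qed.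
Lemma fps_coefM f g k :
  fps_coef (f * g) k = \sum_(i < k.+1) fps_coef f i * fps_coef g (k - i)%N.
Proof. by []. Qed.

Definition fpsX : fps R := Fps (fun k => (k == 1)%:R).

End FpsComRing.

Arguments fpsX {R}.

Section FpsUnitRing.
Variable R : comUnitRingType.
Implicit Types f g : fps R.

Definition fps_unit : pred (fps R) :=
  fun f => fps_coef f 0 \is a GRing.unit.

(* The coefficients of degrees 0, ..., n - 1 of the inverse of f, obtained by   *)
(* solving f * g = 1 degree by degree.                                          *)
Fixpoint fps_inv_seq f n : seq R :=
  if n is m.+1 then
    let s := fps_inv_seq f m in
    rcons s ((fps_coef f 0)^-1 *
      ((m == 0)%:R - \sum_(i < m) fps_coef f i.+1 * s`_(m - i.+1)))
  else [::].

(* As usual in MathComp, the inverse of a non-unit is the non-unit itself.      *)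
Definition fps_inv f : fps R :=
  if fps_unit f then Fps (fun k => (fps_inv_seq f k.+1)`_k) else f.

Fact size_fps_inv_seq f n : size (fps_inv_seq f n) = n.
Proof. by elim: n => //= n IHn; rewrite size_rcons IHn. Qed.

Fact nth_fps_inv_seq f n k : (k < n)%N ->
  (fps_inv_seq f n)`_k = (fps_inv_seq f k.+1)`_k.
Proof.
elim: n => // n IHn; rewrite ltnS leq_eqVlt => /predU1P[-> //|kn].
by rewrite -IHn //= nth_rcons size_fps_inv_seq kn.
Qed.

Fact fps_mulVr : {in fps_unit, left_inverse 1 fps_inv *%R}.
Proof.
move=> f uf; have uf0 : fps_coef f 0 \is a GRing.unit := uf.
rewrite mulrC /fps_inv ifT //; apply: fpsP => k; rewrite fps_coefM big_ord_recl.
rewrite (eq_bigr (fun i : 'I_k =>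
  fps_coef f i.+1 * (fps_inv_seq f k)`_(k - i.+1))) => [|i _].
  rewrite subn0 /= nth_rcons size_fps_inv_seq ltnn eqxx.
  by rewrite mulrA mulrV // mul1r subrK.
congr (_ * _); apply/esym/nth_fps_inv_seq.
by rewrite ltn_subrL (leq_ltn_trans _ (ltn_ord i)).
Qed.

Fact fps_unitPl f g : g * f = 1 -> fps_unit f.
Proof.
move=> /(congr1 (fun h => fps_coef h 0)).
rewrite fps_coefM big_ord1 subn0 fps_coef1 /fps_unit => gf1.
by apply/unitrPr; exists (fps_coef g 0); rewrite mulrC.
Qed.

Fact fps_inv_out : {in [predC fps_unit], fps_inv =1 id}.
Proof. by move=> f nuf; rewrite /fps_inv ifN. Qed.

HB.instance Definition _ := GRing.ComNzRing_hasMulInverse.Build (fps R)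
  fps_mulVr fps_unitPl fps_inv_out.

End FpsUnitRing.

Section FpsLimits.
Variable R : comUnitRingType.

(* Convergence for the X-adic topology: each coefficient is eventually          *)
(* constant.                                                                    *)
Definition fps_cvg (u : nat -> fps R) (l : fps R) : Prop :=
  forall k, exists N, forall n, (N <= n)%N -> fps_coef (u n) k = fps_coef l k.

Lemma fps_cvg_unique (u : nat -> fps R) (l l' : fps R) :
  fps_cvg u l -> fps_cvg u l' -> l = l'.
Proof.
move=> ul ul'; apply: fpsP => k; have [N uN] := ul k; have [N' uN'] := ul' k.
by rewrite -(uN (maxn N N')) ?leq_maxl // uN' // leq_maxr.
Qed.

(* The limit of u, with the junk value 0 when u diverges.                       *)
Definition fps_lim (u : nat -> fps R) : fps R := xget 0 (fps_cvg u).

Lemma fps_limE (u : nat -> fps R) (l : fps R) : fps_cvg u l -> fps_lim u = l.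
Proof.
move=> ul; apply: (@fps_cvg_unique u) => //.
exact: (@xgetPex _ 0 (fps_cvg u) (ex_intro _ l ul)).
Qed.

(* Unconditional summability of F with sum S: the finite partial sums, directed *)
(* by inclusion, converge X-adically to S. No order of summation is chosen.     *)
Definition fps_has_sum (I : eqType) (F : I -> fps R) (S : fps R) : Prop :=
  forall k, exists A : seq I, forall B : seq I, uniq B -> {subset A <= B} ->
    fps_coef (\sum_(i <- B) F i) k = fps_coef S k.

End FpsLimits.

Definition qpoch (A : comNzRingType) (a q : A) (m : nat) : A :=
  \prod_(j < m) (1 - a * q ^+ j).

Definition qpoch_inf (R : comUnitRingType) (a q : fps R) : fps R :=
  fps_lim (qpoch a q).

Section QpochInf.
Variable R : comUnitRingType.
Implicit Types a q f g : fps R.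

Fact fps_coefXn_lt q j k :
  fps_coef q 0 = 0 -> (k < j)%N -> fps_coef (q ^+ j) k = 0.
Proof.
move=> q0; elim: j k => // j IHj k kj; rewrite exprS fps_coefM.
apply: big1 => -[[|i] /= ik] _; first by rewrite q0 mul0r.
by rewrite IHj ?mulr0 //; lia.
Qed.

(* The junk value of fps_lim is never met in qpoch_inf when q has no constant   *)
(* term.                                                                        *)
Lemma qpoch_inf_cvg a q :
  fps_coef q 0 = 0 -> fps_cvg (qpoch a q) (qpoch_inf a q).
Proof.
move=> q0.
suff [l ql] : exists l, fps_cvg (qpoch a q) l by rewrite /qpoch_inf (fps_limE ql).
exists (Fps (fun k => fps_coef (qpoch a q k.+1) k)) => k; exists k.+1 => n.
elim: n => // n IHn; rewrite leq_eqVlt => /predU1P[<- //|kn].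
have -> : qpoch a q n.+1 = qpoch a q n * (1 - a * q ^+ n).
  exact: big_ord_recr.
rewrite -(IHn kn) mulrBr mulr1 mulrA fps_coefD fps_coefN.
rewrite fps_coefM big1 ?subr0 // => i _.
by rewrite fps_coefXn_lt ?mulr0 // (leq_ltn_trans (leq_subr _ _)).
Qed.

End QpochInf.

(* Main.v *)
Require Import Defs.
From mathcomp Require Import all_boot all_algebra.
From mathcomp Require Import ring zify.

Set Implicit Arguments.
Unset Strict Implicit.
Unset Printing Implicit Defensive.

Import GRing.Theory.
Local Open Scope ring_scope.

(** Put p = q^2 and L = n + r. The exponent n^2 + 2nr + 3r^2 equals L^2 + 2r^2,
so the double sum is
  sum_L q^(L^2) (-q;p)_L be'_L,
  be'_L = sum_(r <= L) p^(r^2) / ((p;p)_(L-r) (p;p)_r (p;p^2)_r).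
The inner sum is one step of the Bailey chain with a = 1, applied to Slater's
Bailey pair C(1),
  be_r = 1 / ((p;p)_r (p;p^2)_r),
  al_(2r) = (-1)^r p^(3r^2-r) (1 + p^(2r)) for r > 0, al_0 = 1, al_odd = 0.
The step multiplies al_k by p^(k^2). The outer sum is a second Bailey step, with
parameter rho = -q; it multiplies al_k by q^(k^2), and turns the double sum into
  (-q;p)_oo / (p;p)_oo * sum_(s in Z) (-1)^s q^(18 s^2 - 2 s).
The Jacobi triple product evaluates this bilateral series as
(q^16,q^20,q^36;q^36)_oo, and (-q;q^2)_oo / (q^2;q^2)_oo = (q^2;q^4)_oo / (q;q)_oo.

The argument is carried out on identities between finite sums, valid in every
commutative ring in which the (p;p)_m are units; the limit is taken once, modulo each power of X.
The carriers are [bailey_lemma] (both Bailey steps at once, by summing the finite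
q-Chu-Vandermonde formula [q_chu_vandermonde]), [slater_pair] (from
[slater_finite]), their combination [finite_identity], and
[finite_jacobi_triple]. The last one and [slater_finite] are proved by
telescoping in the summation bound.

Bilateral sums over s in Z are folded: the terms of index s and -s are
collected in [theta_term], and only s >= 0 is summed. *)

(** * Gaussian binomial coefficients *)

(** Proves an equation from an earlier one by exhibiting the multiple of it that
accounts for the difference; the side condition is left to [ring]. *)
Lemma eq_lincomb (A : comNzRingType) (c a b d e : A) :
  a = b -> d - e = c * (a - b) -> d = e.
Proof. by move=> ->; rewrite subrr mulr0 => /eqP; rewrite subr_eq0 => /eqP. Qed.

Arguments eq_lincomb {A} c {a b d e}.

Section GaussianBinomials.
Variables (A : comNzRingType) (p : A).
Implicit Types n m k N M : nat.

(** The recursion makes sense in any ring, without dividing by 1 - p^k, and gives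
the value 0 when k > n. *)
Fixpoint qbin n k : A :=
  match n, k with
  | _, 0 => 1
  | 0, _.+1 => 0
  | n'.+1, k'.+1 => qbin n' k' + p ^+ k'.+1 * qbin n' k'.+1
  end.

Lemma qbin0 n : qbin n 0 = 1. Proof. by case: n. Qed.

Lemma qbinS n k : qbin n.+1 k.+1 = qbin n k + p ^+ k.+1 * qbin n k.+1.
Proof. by []. Qed.

Arguments qbin : simpl never.

Lemma qbin_small n k : (n < k)%N -> qbin n k = 0.
Proof.
elim: n k => [|n IHn] [|k] // nk.
by rewrite qbinS !IHn ?mulr0 ?addr0 // ltnW.
Qed.

(** The two ratios of neighbouring entries in a row of the q-Pascal triangle,
without denominators. *)
Lemma qbin_absorb n k : (k <= n)%N ->
  (1 - p ^+ k.+1) * qbin n k.+1 = (1 - p ^+ (n - k)) * qbin n k.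
Proof.
elim: n k => [|n IHn] k.
  by case: k => // _; rewrite qbin_small // expr0 subrr !(mulr0, mul0r).
rewrite leq_eqVlt => /predU1P[->|].
  by rewrite qbin_small // subnn subrr mulr0 mul0r.
case: k => [|k] kn.
  have := IHn 0 isT; rewrite !qbinS !qbin0 !subn0 expr1 (exprS p n) => E.
  by apply: (eq_lincomb p E); ring.
have := IHn k.+1 kn; have := IHn k (ltnW kn); rewrite subSS !qbinS.
have -> : (n - k = (n - k.+1).+1)%N by rewrite subnSK.
move=> E1 E2; rewrite exprSr.
rewrite !exprS in E1 E2 *.
apply: (eq_lincomb (p * (p * p ^+ k)) E2).
apply: (eq_lincomb 1 E1); ring.
Qed.

Lemma qbinS_dual n k : (k <= n)%N ->
  qbin n.+1 k.+1 = qbin n k.+1 + p ^+ (n - k) * qbin n k.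
Proof.
by move=> kn; apply: (eq_lincomb (- 1) (qbin_absorb kn)); rewrite qbinS; ring.
Qed.

Lemma qbin_sym m k : qbin (m + k) k = qbin (m + k) m.
Proof.
elim: m k => [|m IHm]; first by move=> k; rewrite qbin0; elim: k => // k IHk;
  rewrite qbinS IHk qbin_small ?mulr0 ?addr0.
elim=> [|k IHk].
  rewrite addn0 qbin0 qbinS (qbin_small (ltnSn m)) mulr0 addr0.
  by have := IHm 0; rewrite addn0 qbin0.
rewrite addnS qbinS IHk qbinS_dual; last by lia.
have -> : (m.+1 + k = m + k.+1)%N by lia.
by rewrite IHm; have -> : (m + k.+1 - m = k.+1)%N by lia.
Qed.

Lemma qbinn n : qbin n n = 1.
Proof. by have := qbin_sym n 0; rewrite addn0 qbin0. Qed.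

Lemma qbinE m k :
  qbin (m + k) k * (qpoch p p k * qpoch p p m) = qpoch p p (m + k).
Proof.
elim: k m => [|k IHk] m; first by rewrite addn0 qbin0 /qpoch big_ord0 !mul1r.
have := IHk m.+1; rewrite addSnnS => <-.
rewrite /qpoch !big_ord_recr /= -!exprS -!/(qpoch _ _ _).
have := @qbin_absorb (m + k.+1) k; have -> : (m + k.+1 - k = m.+1)%N by lia.
move=> abs; have {}abs := abs ltac:(lia).
transitivity ((1 - p ^+ k.+1) * qbin (m + k.+1) k.+1 * (qpoch p p k * qpoch p p m)); first by ring.
rewrite abs; ring.
Qed.

(** Central indexing: row 2N, at distance k from the middle. It vanishes for k > N,
and [cbin p N k / (p;p)_(2N)] is the Bailey kernel 1 / ((p;p)_(N-k) (p;p)_(N+k)). *)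
Definition cbin N k := qbin N.*2 (N + k).

Lemma cbin_small N k : (N < k)%N -> cbin N k = 0.
Proof. by move=> Nk; apply: qbin_small; lia. Qed.

Lemma cbinn N : cbin N N = 1.
Proof. by rewrite /cbin addnn qbinn. Qed.

Lemma cbin_absorb N k : (k <= N)%N ->
  (1 - p ^+ (N + k).+1) * cbin N k.+1 = (1 - p ^+ (N - k)) * cbin N k.
Proof.
move=> kN; rewrite /cbin addnS qbin_absorb; last by lia.
by have -> : (N.*2 - (N + k) = N - k)%N by lia.
Qed.

(** The case k = -1 of [cbin_rec], folded by the symmetry k <-> -k; hence the
factor 2. *)
Lemma cbin_rec0 N :
  cbin N.+1 0 = (1 + p ^+ N.*2.+1) * cbin N 0 + 2%:R * p ^+ N.+1 * cbin N 1.
Proof.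
rewrite /cbin !addn0 addn1 doubleS qbinS.
have -> : qbin N.*2.+1 N = qbin N.*2.+1 N.+1.
  have := qbin_sym N N.+1; have -> : (N + N.+1 = N.*2.+1)%N by lia.
  by [].
have E1 := qbinS N.*2 N.
have := @qbinS_dual N.*2 N; have -> : (N.*2 - N = N)%N by lia.
move=> E2; have {}E2 := E2 ltac:(lia).
rewrite {2}E2 E1 -addnn -addSn exprD; ring.
Qed.

(** Both q-Pascal rules in succession, chosen so that the coefficient of the middle
term does not depend on k. *)
Lemma cbin_rec N k : (k <= N)%N ->
  cbin N.+1 k.+1 = (1 + p ^+ N.*2.+1) * cbin N k.+1 + p ^+ (N - k) * cbin N k
    + p ^+ (N + k.+2) * cbin N k.+2.
Proof.
move=> kN; rewrite /cbin doubleS.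
have -> : (N.+1 + k.+1 = (N + k.+1).+1)%N by lia.
rewrite qbinS {1}addnS qbinS_dual; last by lia.
have -> : (N.*2 - (N + k) = N - k)%N by lia.
have [kN1|Nk] := leqP k.+1 N; last first.
  have small n j : (n < j)%N -> qbin n j = 0 := @qbin_small n j.
  rewrite !(small N.*2.+1) ?(small N.*2 (N + k).+1) ?(small N.*2 (N + k.+1)%N)
    ?(small N.*2 (N + k.+2)%N); try lia.
  by rewrite !mulr0 !add0r !addr0.
rewrite qbinS_dual; last by lia.
have -> : (N.*2 - (N + k.+1) = N - k.+1)%N by lia.
have -> : (N.*2.+1 = (N + k.+2) + (N - k.+1))%N by lia.
rewrite -!addnS (exprD p (N + k.+2) (N - k.+1)); ring.
Qed.

Lemma cbinE N k : (k <= N)%N ->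
  cbin N k * (qpoch p p (N - k) * qpoch p p (N + k)) = qpoch p p N.*2.
Proof.
move=> kN; have := qbinE (N - k) (N + k).
have -> : (N - k + (N + k) = N.*2)%N by lia.
by rewrite (mulrC (qpoch p p (N + k))).
Qed.

End GaussianBinomials.
Arguments qbin : simpl never.

(** * Finite forms of two theta series *)

Section FiniteTheta.
Variable A : comNzRingType.
Implicit Types (p q x y z : A) (m n r s M N : nat).

Lemma qpochS x q m : qpoch x q m.+1 = qpoch x q m * (1 - x * q ^+ m).
Proof. exact: big_ord_recr. Qed.

(** The terms of index s and -s (for s = 0, the one term 1) of the theta series
sum_(s in Z) (-1)^s z^s q^(s(s-1)/2), in which z^(-s) q^(s(s+1)/2) is written
y^s q^(s(s-1)/2) with z y = q. *)
Definition theta_term z y q s : A :=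
  if s is 0 then 1 else (- 1) ^+ s * q ^+ 'C(s, 2) * (z ^+ s + y ^+ s).

Arguments theta_term : simpl never.

Lemma theta_termS z y q s : theta_term z y q s.+1 =
  - ((- 1) ^+ s * q ^+ 'C(s, 2)) * q ^+ s * (z * z ^+ s + y * y ^+ s).
Proof. by rewrite /theta_term binS bin1 exprD !exprS; ring. Qed.

(** Because 2 * s(s-1)/2 + s = s^2, a Gaussian factor w^(s^2) is absorbed by
rescaling the parameters; this is how a Bailey step acts on the theta terms. *)
Lemma theta_term_scale z y q w s :
  w ^+ (s ^ 2) * theta_term z y q s =
  theta_term (w * z) (w * y) (w ^+ 2 * q) s.
Proof.
elim: s => [|s _]; first by rewrite /theta_term mulr1.
rewrite !theta_termS.
have -> : (s.+1 ^ 2 = 2 * 'C(s, 2) + 2 * s + s.+1)%N.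
  by elim: s => // s IHs; rewrite binS bin1; lia.
by rewrite !exprD !exprMn (exprS w s) expr0; ring.
Qed.

(** The folded sum over |s| <= m telescopes: after [cbin_rec] the terms
(z + y) q^M cbin M s cancel against shifted terms, because
t_(s+1) = - z q^s t_s and t_(s-1) q^s = - y t_s for the unfolded terms. Only the
terms at the boundary m remain. *)
Lemma theta_partial z y q M m : z * y = q -> (m <= M)%N ->
  \sum_(s < m.+1) theta_term z y q s *
    (cbin q M.+1 s - (1 - z * q ^+ M) * (1 - y * q ^+ M) * cbin q M s) =
  (- 1) ^+ m * q ^+ 'C(m, 2) * (z ^+ m + y ^+ m) * q ^+ (M + m.+1) * cbin q M m.+1
  - theta_term z y q m.+1 * q ^+ (M - m) * cbin q M m.
Proof.
move=> zy; elim: m => [|m IHm] mM.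
  rewrite big_ord1 theta_termS /theta_term cbin_rec0 /= subn0 addn1.
  rewrite -addnn -addnS exprD !exprS !expr0 /=.
  by apply: (eq_lincomb (- (q ^+ M * q ^+ M * cbin q M 0)) zy); ring.
rewrite big_ord_recr IHm ?(ltnW mM) //= cbin_rec ?(ltnW mM) //.
rewrite !theta_termS.
have -> : (M - m = (M - m.+1).+1)%N by lia.
have -> : (M.*2.+1 = (M + M).+1)%N by lia.
have EM : q ^+ M = q ^+ (M - m.+1) * q ^+ m * q by rewrite -exprD -exprSr; congr (q ^+ _); lia.
rewrite binS bin1 (exprD q _ m) !exprS !addnS !exprS !exprD EM.
move: (cbin q M m) (cbin q M m.+1) (cbin q M m.+2) => b0 b1 b2.
move: (q ^+ (M - m.+1)) (q ^+ 'C(m, 2)) (q ^+ m) (z ^+ m) (y ^+ m) ((- 1) ^+ m).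
by move=> D c Q Z Y e; rewrite -zy; ring.
Qed.

Lemma finite_jacobi_triple z y q M : z * y = q ->
  \sum_(s < M.+1) theta_term z y q s * cbin q M s =
  qpoch z q M * qpoch y q M.
Proof.
move=> zy; elim: M => [|M IHM].
  by rewrite big_ord1 cbinn /qpoch !big_ord0 !mulr1.
have := theta_partial zy (leqnn M); rewrite cbin_small // mulr0 sub0r.
rewrite subnn cbinn expr0 !mulr1 => E.
rewrite big_ord_recr /= cbinn mulr1 !qpochS.
transitivity ((1 - z * q ^+ M) * (1 - y * q ^+ M) *
    \sum_(s < M.+1) theta_term z y q s * cbin q M s); last by rewrite IHM; ring.
rewrite big_distrr /=; apply/eqP; rewrite -subr_eq0 addrAC -sumrB.
rewrite addr_eq0 -E; apply/eqP/eq_bigr => s _; ring.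
Qed.

(** Here too the folded sum over |r| <= m telescopes. The induction step is a
combination of [cbin_rec] at 2m + 1 with [cbin_absorb] at 2m + 1 and 2m + 2;
the right-hand side vanishes as soon as 2m >= N. *)
Lemma slater_partial p N m :
  \sum_(r < m.+1) theta_term (p ^+ 2) (p ^+ 4) (p ^+ 6) r *
    (cbin p N.+1 r.*2 - (1 + p ^+ N.+1) * cbin p N r.*2) =
  (- 1) ^+ m * (p ^+ 6) ^+ 'C(m, 2) * p ^+ m.*2 ^+ 3 *
    (1 + p ^+ N.+1) * p ^+ N.+1 * cbin p N m.*2.+1.
Proof.
elim: m => [|m IHm].
  have := cbin_absorb p (leq0n N); rewrite subn0 addn0 => E.
  rewrite big_ord1 /theta_term mul1r cbin_rec0 -addnn -addnS exprD.
  rewrite double0 (exprS p N) in E *.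
  by apply: (eq_lincomb (p * p ^+ N) E); rewrite !expr0 /=; ring.
rewrite big_ord_recr {}IHm /= !doubleS.
have [Nm|mN] := leqP N m.*2.
  rewrite !(@cbin_small _ p N m.*2.+1) ?(@cbin_small _ p N.+1 m.*2.+2)
    ?(@cbin_small _ p N m.*2.+2) ?(@cbin_small _ p N m.*2.+3); try lia.
  by rewrite !mulr0 subrr mulr0 addr0.
rewrite cbin_rec // theta_termS.
have E2 := cbin_absorb p mN.
(* The factor p makes the relation true also at N = 2m + 1, where both sides
   vanish. *)
have E3 : p * ((1 - p ^+ (N + m.*2.+2).+1) * cbin p N m.*2.+3) =
    (p - p ^+ (N - m.*2.+1)) * cbin p N m.*2.+2.
  have [mN2|Nm2] := leqP m.*2.+2 N.
    rewrite cbin_absorb //; have -> : (N - m.*2.+1 = (N - m.*2.+2).+1)%N by lia.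
    by rewrite exprS; ring.
  by rewrite !cbin_small ?mulr0 //; lia.
(* All exponents become combinations of d, u and p, so that no truncated
   subtraction remains. *)
set d := p ^+ (N - m.*2.+1) in E2 E3 *; pose u := p ^+ m.
have powE a i j k : (a = (N - m.*2.+1) * i + m * j + k)%N ->
    p ^+ a = d ^+ i * u ^+ j * p ^+ k.
  by move=> ->; rewrite /d /u !exprD !exprM.
have E6 : p ^+ 6 ^+ m = u ^+ 6 by rewrite /u -!exprM mulnC.
have Ez : p ^+ 2 ^+ m = u ^+ 2 by rewrite /u -!exprM mulnC.
have Ey : p ^+ 4 ^+ m = u ^+ 4 by rewrite /u -!exprM mulnC.
rewrite (powE (N + m.*2.+1).+1%N 1 4 3) in E2; last by lia.
rewrite (powE (N + m.*2.+2).+1%N 1 4 4) in E3; last by lia.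
rewrite (powE (N + m.*2.+3)%N 1 4 4); last by lia.
rewrite (powE N.+1%N 1%N 2%N 2%N); last by lia.
rewrite (powE N.*2.+1%N 2%N 4%N 3%N); last by lia.
rewrite (powE m.*2.+2%N 0%N 2%N 2%N); last by lia.
rewrite (powE m.*2%N 0%N 2%N 0%N); last by lia.
rewrite binS bin1 exprD (exprS _ m) E6 Ez Ey.
move: E2 E3.
move: (cbin p N m.*2.+1) (cbin p N m.*2.+2) (cbin p N m.*2.+3) => b1 b2 b3.
move: (p ^+ 6 ^+ 'C(m, 2)) ((- 1) ^+ m) => c e E2 E3.
(* K is the common factor of the two boundary terms, up to sign and powers of p
   and u. *)
pose K := - (e * c) * u ^+ 6 * (d * u ^+ 2 * p ^+ 2).
apply: (eq_lincomb (K * (p ^+ 3 * u ^+ 4)) E3).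
by apply: (eq_lincomb (- K * (p ^+ 2 * u ^+ 2)) E2); rewrite /K; ring.
Qed.

(** With z = p^2, y = p^4 and base p^6 the theta terms are
(-1)^r (p^(3r^2-r) + p^(3r^2+r)), so this is Slater's pair C(1) multiplied by
(p;p)_(2N). *)
Lemma slater_finite p N :
  \sum_(r < N.+1) theta_term (p ^+ 2) (p ^+ 4) (p ^+ 6) r * cbin p N r.*2 =
  qpoch (- p) p N.
Proof.
elim: N => [|N IHN]; first by rewrite big_ord1 cbinn mulr1 /qpoch big_ord0.
have := slater_partial p N N.+1; rewrite cbin_small ?mulr0; last by lia.
move=> E; rewrite qpochS -{}IHN.
transitivity ((1 + p ^+ N.+1) *
  \sum_(r < N.+2) theta_term (p ^+ 2) (p ^+ 4) (p ^+ 6) r * cbin p N r.*2).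
  rewrite big_distrr /=; apply/eqP; rewrite -subr_eq0 -sumrB; apply/eqP.
  by rewrite -[RHS]E; apply: eq_bigr => r _; ring.
rewrite big_ord_recr /= cbin_small; last by lia.
by rewrite mulr0 addr0 mulNr opprK -exprS mulrC.
Qed.

End FiniteTheta.

(** * The finite q-Chu-Vandermonde sum *)

Section ChuVandermonde.
Variable A : comNzRingType.
Implicit Types (c p q x y : A) (m n j k L M N : nat).

Lemma qpochD x q m n :
  qpoch x q (m + n) = qpoch x q m * qpoch (x * q ^+ m) q n.
Proof.
rewrite /qpoch big_split_ord /=; congr (_ * _); apply: eq_bigr => i _.
by rewrite exprD mulrA.
Qed.

Lemma qpoch_even x q m :
  qpoch x q m.*2 = qpoch x (q ^+ 2) m * qpoch (x * q) (q ^+ 2) m.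
Proof.
elim: m => [|m IHm]; first by rewrite /qpoch !big_ord0 mulr1.
rewrite doubleS !qpochS {}IHm (exprS q m.*2) -mul2n exprM; ring.
Qed.

Lemma qpoch_sqr x q m :
  qpoch x q m * qpoch (- x) q m = qpoch (x ^+ 2) (q ^+ 2) m.
Proof.
rewrite /qpoch -big_split; apply: eq_bigr => i _ /=.
by rewrite -exprM mulnC exprM; ring.
Qed.

(** This is homogeneous in (c, x): it equals x^j (c/x;p)_j up to sign and a power of
p, and it keeps a meaning at x = 0, where it is c^j p^(j(j-1)). *)
Definition cv_weight p c x j := \prod_(i < j) (p ^+ i * (c * p ^+ i - x)).

Lemma cv_weightSl p c x j :
  cv_weight p c x j.+1 = (c - x) * p ^+ j * cv_weight p (c * p) x j.
Proof.
rewrite /cv_weight big_ord_recl !expr0 mul1r mulr1 -mulrA; congr (_ * _).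
elim: j => [|j IHj]; first by rewrite !big_ord0 mulr1.
by rewrite !big_ord_recr /= {}IHj /bump /= add1n !exprS; ring.
Qed.

(** The usual formula sums 2phi1(p^(-M), c/x; c; p, x p^M) to (x;p)_M / (c;p)_M; here it
is multiplied by (c;p)_M, so that nothing is divided. In the induction the dual
q-Pascal rule splits the sum into the case M at c and the case M at c p. *)
Lemma q_chu_vandermonde p c x M :
  \sum_(j < M.+1) qbin p M j * cv_weight p c x j * qpoch (c * p ^+ j) p (M - j)
  = qpoch x p M.
Proof.
elim: M c => [|M IHM] c.
  by rewrite big_ord1 /cv_weight /qpoch !big_ord0 !mulr1.
pose F c0 j := qbin p M j * cv_weight p c0 x j * qpoch (c0 * p ^+ j) p (M - j).
have {}IHM c0 : \sum_(j < M.+1) F c0 j = qpoch x p M by exact: IHM.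
(* The two halves of the dual q-Pascal rule, padded to the range j <= M + 1. *)
pose G j : A := if j is j'.+1 then p ^+ M * (c - x) * F (c * p) j' else 0.
transitivity (\sum_(j < M.+2)
  ((1 - c * p ^+ M) * (if (j <= M)%N then F c j else 0) + G j)).
  apply: eq_bigr => -[j /= jM] _; rewrite /F /G; case: ifP => [jM'|].
    case: j jM jM' => [|j] jM jM' /=; rewrite /F.
      by rewrite !qbin0 !subn0 qpochS expr0; ring.
    have -> : c * p * p ^+ j = c * p ^+ j.+1 by rewrite exprS mulrA.
    rewrite subSS qbinS_dual ?(ltnW jM') // cv_weightSl.
    have -> : (M - j = (M - j.+1).+1)%N by lia.
    have EM : p ^+ M = p ^+ j * p ^+ (M - j.+1) * p.
      by rewrite -exprD -exprSr; congr (p ^+ _); lia.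
    by rewrite qpochS (exprS p j) EM exprS; ring.
  case: j jM => [//|j] jM /= jM'; rewrite /F; have -> : j = M by lia.
  rewrite !qbinn !subnn cv_weightSl /qpoch !big_ord0; ring.
rewrite big_split /= -big_distrr /= big_ord_recr /= ltnn addr0.
rewrite [X in _ + X]big_ord_recl /= add0r -big_distrr /= IHM.
rewrite (eq_bigr (fun j : 'I_M.+1 => F c j)) => [|j _]; last first.
  by rewrite -ltnS ltn_ord.
by rewrite IHM qpochS; ring.
Qed.

End ChuVandermonde.

(** * The Bailey chain *)

Section Bailey.
Variables (A : comUnitRingType) (p : A).
Implicit Types (q y : A) (al be : nat -> A) (j k L M N r : nat).

Hypothesis pU : forall m, qpoch p p m \is a GRing.unit.

(** Bailey pairs relative to a = 1. *)
Definition bailey_pair al be := forall N,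
  be N = \sum_(k < N.+1) al k / (qpoch p p (N - k) * qpoch p p (N + k)).

(** In terms of the usual parameter rho, with y = p / rho, this is
(rho;p)_L (p/rho)^L p^(L(L-1)/2) up to sign: the weight of the Bailey lemma whose
second parameter has been sent to infinity. *)
Definition bailey_weight y L := \prod_(i < L) (p ^+ i * (p ^+ i.+1 - y)).

Lemma bailey_weightD y k j : bailey_weight y (k + j) =
  bailey_weight y k * cv_weight p (p ^+ k.*2.+1) (y * p ^+ k) j.
Proof.
rewrite /bailey_weight big_split_ord /=; congr (_ * _).
apply: eq_bigr => i _; rewrite -addnn -addnS !exprD.
by rewrite !exprS !exprD; ring.
Qed.

(** The q-Chu-Vandermonde sum with c = p^(2k+1) and x = y p^k. *)
Lemma bailey_kernel y k M :
  \sum_(j < M.+1) bailey_weight y (k + j) /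
    (qpoch p p (M - j) * (qpoch p p j * qpoch p p (k.*2 + j))) =
  bailey_weight y k * qpoch (y * p ^+ k) p M /
    (qpoch p p M * qpoch p p (k.*2 + M)).
Proof.
rewrite -(q_chu_vandermonde p (p ^+ k.*2.+1)) big_distrr big_distrl /=.
apply: eq_bigr => -[j /= jM] _; rewrite bailey_weightD.
rewrite ltnS in jM.
have EM : qpoch p p M = qbin p M j * (qpoch p p j * qpoch p p (M - j)).
  by have := qbinE p (M - j) j; rewrite subnK.
have EkM : qpoch p p (k.*2 + M) =
    qpoch p p (k.*2 + j) * qpoch (p ^+ k.*2.+1 * p ^+ j) p (M - j).
  have -> : (k.*2 + M = k.*2 + j + (M - j))%N by lia.
  by rewrite qpochD -exprD addSn exprS.
apply/(canRL (mulrK _)); first by rewrite unitrM !pU.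
rewrite mulrAC; apply/(canLR (mulrK _)); first by rewrite !unitrM !pU.
by rewrite EM EkM; ring.
Qed.

(** Exchanging the sums over L and k reduces the claim to [bailey_kernel] for each k. *)
Lemma bailey_lemma y al be N : bailey_pair al be ->
  \sum_(L < N.+1) bailey_weight y L * be L / qpoch p p (N - L) =
  \sum_(k < N.+1) bailey_weight y k * qpoch (y * p ^+ k) p (N - k) * al k /
    (qpoch p p (N - k) * qpoch p p (N + k)).
Proof.
move=> ab.
pose F L k := al k * (bailey_weight y L /
  (qpoch p p (N - L) * (qpoch p p (L - k) * qpoch p p (L + k)))).
transitivity (\sum_(L < N.+1) \sum_(k < N.+1 | (k <= L)%N) F L k).
  apply: eq_bigr => L _.
  transitivity (\sum_(k < L.+1) F L k); last by rewrite (big_ord_widen N.+1 (F L)).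
  rewrite ab big_distrr big_distrl /=; apply: eq_bigr => k _; rewrite /F.
  by rewrite [in RHS]invrM ?unitrM ?pU //; ring.
rewrite (exchange_big_dep xpredT) //=; apply: eq_bigr => -[k /= kN] _.
rewrite ltnS in kN.
transitivity (\sum_(k <= L < N.+1) F L k); first by rewrite big_geq_mkord.
rewrite -{1}(add0n k) big_addn big_mkord subSn //.
transitivity (al k * \sum_(j < (N - k).+1) bailey_weight y (k + j) /
    (qpoch p p (N - k - j) * (qpoch p p j * qpoch p p (k.*2 + j)))).
  rewrite big_distrr /=; apply: eq_bigr => j _; rewrite /F.
  have -> : (N - (j + k) = N - k - j)%N by lia.
  have -> : (j + k - k = j)%N by lia.
  have -> : (j + k + k = k.*2 + j)%N by lia.
  by rewrite addnC.
rewrite bailey_kernel; have -> : (k.*2 + (N - k) = N + k)%N by lia.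
ring.
Qed.

Lemma bailey_weight0 L : bailey_weight 0 L = p ^+ (L ^ 2).
Proof.
elim: L => [|L IHL]; first by rewrite /bailey_weight big_ord0.
rewrite /bailey_weight big_ord_recr /= -/(bailey_weight 0 L) IHL subr0 -!exprD.
by congr (p ^+ _); lia.
Qed.

Lemma bailey_weight_half q L : p = q ^+ 2 ->
  bailey_weight (- q) L = q ^+ (L ^ 2) * qpoch (- q) p L.
Proof.
move=> pq; elim: L => [|L IHL]; first by rewrite /bailey_weight /qpoch !big_ord0 mulr1.
rewrite /bailey_weight big_ord_recr /= -/(bailey_weight (- q) L) IHL qpochS.
have -> : (L.+1 ^ 2 = L ^ 2 + (2 * L).+1)%N by lia.
have -> : p ^+ L.+1 = q * q * p ^+ L by rewrite exprS {1}pq expr2.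
by rewrite (exprD q) (exprS q) exprM -pq; ring.
Qed.

Lemma bailey_step al be : bailey_pair al be ->
  bailey_pair (fun k => p ^+ (k ^ 2) * al k)
    (fun N => \sum_(L < N.+1) p ^+ (L ^ 2) * be L / qpoch p p (N - L)).
Proof.
move=> ab N; have := bailey_lemma 0 N ab.
under eq_bigr => L _ do rewrite bailey_weight0.
move=> ->; apply: eq_bigr => k _; rewrite bailey_weight0 mul0r.
rewrite [qpoch 0 _ _]big1 ?mulr1 // => i _; by rewrite mul0r subr0.
Qed.

Lemma bailey_step_half q al be N : p = q ^+ 2 -> bailey_pair al be ->
  \sum_(L < N.+1) q ^+ (L ^ 2) * qpoch (- q) p L * be L / qpoch p p (N - L) =
  qpoch (- q) p N *
    \sum_(k < N.+1) q ^+ (k ^ 2) * al k / (qpoch p p (N - k) * qpoch p p (N + k)).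
Proof.
move=> pq ab; have := bailey_lemma (- q) N ab.
under eq_bigr => L _ do rewrite bailey_weight_half //.
move=> ->; rewrite big_distrr; apply: eq_bigr => -[k /= kN] _.
have -> : qpoch (- q) p N = qpoch (- q) p k * qpoch (- q * p ^+ k) p (N - k).
  by rewrite -qpochD subnKC.
by rewrite bailey_weight_half //; ring.
Qed.

(** Slater's pair C(1) has al_k = 0 for odd k. *)
Definition on_evens (a : nat -> A) k : A := if odd k then 0 else a k./2.

Lemma sum_on_evens (a g : nat -> A) n :
  \sum_(k < n.*2) on_evens a k * g k = \sum_(r < n) a r * g r.*2.
Proof.
elim: n => [|n IHn]; first by rewrite !big_ord0.
rewrite doubleS !big_ord_recr /= {}IHn /on_evens /= odd_double /= doubleK.
by rewrite mul0r addr0.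
Qed.

Lemma bailey_sum_on_evens (a : nat -> A) N :
  \sum_(k < N.+1) on_evens a k / (qpoch p p (N - k) * qpoch p p (N + k)) =
  (\sum_(r < N.+1) a r * cbin p N r.*2) / qpoch p p N.*2.
Proof.
rewrite -sum_on_evens -[N.+1.*2]addnn big_split_ord /=.
rewrite [X in _ = (_ + X) / _]big1 ?addr0 => [|k _]; last first.
  by rewrite cbin_small ?mulr0 // addSn ltnS leq_addr.
rewrite big_distrl /=; apply: eq_bigr => -[k /= kN] _; rewrite -mulrA.
rewrite ltnS in kN; congr (_ * _); rewrite -(cbinE p kN).
set u := _ * qpoch p p (N + k); have uU : u \is a GRing.unit by rewrite unitrM !pU.
have := pU N.*2; rewrite -(cbinE p kN) unitrM => /andP[cU _].
by move: (u) uU => v vU; rewrite invrM // mulrA mulrAC divrr // mul1r.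
Qed.

Lemma slater_pair :
  bailey_pair (on_evens (theta_term (p ^+ 2) (p ^+ 4) (p ^+ 6)))
    (fun r => (qpoch p p r * qpoch p (p ^+ 2) r)^-1).
Proof.
move=> N; rewrite bailey_sum_on_evens slater_finite.
have E : qpoch p p N.*2 =
    qpoch p p N * qpoch p (p ^+ 2) N * qpoch (- p) p N.
  by rewrite qpoch_even -expr2 -qpoch_sqr; ring.
have := pU N.*2; rewrite E unitrM => /andP[uU vU].
by move: (_ * _) uU => u uU; rewrite invrM // mulrA divrr // mul1r.
Qed.

(** Two Bailey steps applied to [slater_pair]. The factor p^(k^2) q^(k^2) at k = 2r is
q^(12 r^2), which moves the parameters (q^4, q^8; q^12) of the theta terms to
(q^16, q^20; q^36). *)
Lemma finite_identity q N : p = q ^+ 2 ->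
  \sum_(L < N.+1) q ^+ (L ^ 2) * qpoch (- q) p L *
     (\sum_(r < L.+1) p ^+ (r ^ 2) * (qpoch p p r * qpoch p (p ^+ 2) r)^-1 /
        qpoch p p (L - r)) / qpoch p p (N - L) =
  qpoch (- q) p N *
    ((\sum_(r < N.+1) theta_term (q ^+ 16) (q ^+ 20) (q ^+ 36) r *
        cbin p N r.*2) / qpoch p p N.*2).
Proof.
move=> pq; rewrite (bailey_step_half N pq (bailey_step slater_pair)).
rewrite -bailey_sum_on_evens; congr (_ * _); apply: eq_bigr => -[k /= _] _.
congr (_ / _); rewrite /on_evens; case: ifPn => [_|kE]; first by rewrite !mulr0.
have -> : theta_term (q ^+ 16) (q ^+ 20) (q ^+ 36) k./2 =
    theta_term (q ^+ 12 * p ^+ 2) (q ^+ 12 * p ^+ 4) ((q ^+ 12) ^+ 2 * p ^+ 6) k./2.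
  by rewrite pq -!exprM -!exprD.
rewrite -theta_term_scale mulrA; congr (_ * _).
rewrite pq -!exprM -exprD; congr (q ^+ _).
by rewrite -{1 2}(even_halfK kE); lia.
Qed.

End Bailey.

(** * Congruences modulo a power of X *)

Section Congruence.
Variable R : comUnitRingType.
Implicit Types (f g h a q : fps R) (k m n M N r s : nat).

(** Congruence modulo X^n. *)
Definition eqX n f g := forall k, (k < n)%N -> fps_coef f k = fps_coef g k.

Lemma eqX_sym n f g : eqX n f g -> eqX n g f.
Proof. by move=> fg k kn; rewrite fg. Qed.

Lemma eqX_trans n g f h : eqX n f g -> eqX n g h -> eqX n f h.
Proof. by move=> fg gh k kn; rewrite fg // gh. Qed.

Lemma eqX_add n f f' g g' : eqX n f f' -> eqX n g g' -> eqX n (f + g) (f' + g').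
Proof. by move=> ff gg k kn; rewrite !fps_coefD ff // gg. Qed.

Lemma eqX_mul n f f' g g' : eqX n f f' -> eqX n g g' -> eqX n (f * g) (f' * g').
Proof.
move=> ff gg k kn; rewrite !fps_coefM; apply: eq_bigr => -[i /= ik] _.
by rewrite ff ?gg //; lia.
Qed.

Lemma eqX_mull n h f g : eqX n f g -> eqX n (h * f) (h * g).
Proof. exact: eqX_mul. Qed.

Lemma eqX_mulr n h f g : eqX n f g -> eqX n (f * h) (g * h).
Proof. by move=> fg; apply: eqX_mul. Qed.

Lemma eqX_sum n (I : Type) (s : seq I) (P : pred I) (F G : I -> fps R) :
  (forall i, P i -> eqX n (F i) (G i)) ->
  eqX n (\sum_(i <- s | P i) F i) (\sum_(i <- s | P i) G i).
Proof.
move=> FG; apply: (big_ind2 (eqX n)) => // f f' g g'; exact: eqX_add.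
Qed.

Lemma eqX_sum0 n (I : Type) (s : seq I) (P : pred I) (F : I -> fps R) :
  (forall i, P i -> eqX n (F i) 0) -> eqX n (\sum_(i <- s | P i) F i) 0.
Proof. by move=> F0; have := eqX_sum s (G := fun=> 0) F0; rewrite big1_eq. Qed.

Lemma eqX_eq f g : (forall n, eqX n f g) -> f = g.
Proof. by move=> fg; apply: fpsP => k; apply: (fg k.+1). Qed.

(** Quotients enter only in this form, so that congruences need not be inverted. *)
Lemma eqX_divr1 n f g : f \is a GRing.unit -> eqX n g f -> eqX n (g / f) 1.
Proof. by move=> uf gf; rewrite -(divrr uf); apply: eqX_mulr. Qed.

Lemma eqX_exp0 n q j : fps_coef q 0 = 0 -> (n <= j)%N -> eqX n (q ^+ j) 0.
Proof. by move=> q0 nj k kn; rewrite fps_coefXn_lt // (leq_trans kn). Qed.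

Lemma coef0X c : (0 < c)%N -> fps_coef ((fpsX : fps R) ^+ c) 0 = 0.
Proof. by move=> c0; rewrite fps_coefXn_lt. Qed.

Lemma fps_unit_coef0 f : fps_coef f 0 = 1 -> f \is a GRing.unit.
Proof.
move=> f0; apply/unitrPr; exists (fps_inv f).
by rewrite mulrC fps_mulVr // unfold_in /fps_unit f0 unitr1.
Qed.

Lemma qpoch_eqX n a q m : fps_coef q 0 = 0 -> (n <= m)%N ->
  eqX n (qpoch a q m) (qpoch a q n).
Proof.
move=> q0 nm; rewrite -(subnKC nm) qpochD -[X in eqX _ _ X]mulr1.
apply: eqX_mull; elim: (m - n)%N => [|j IHj]; first by rewrite /qpoch big_ord0.
rewrite qpochS -[X in eqX _ _ X]mulr1; apply: eqX_mul => //.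
rewrite -[X in eqX _ _ X]subr0; apply: eqX_add => // k kn.
rewrite !fps_coefN; congr (- _); rewrite -mulrA -exprD.
have := eqX_mull a (eqX_exp0 q0 (leq_addr j n)); rewrite mulr0; exact.
Qed.

Lemma qpoch_inf_eqX n a q m : fps_coef q 0 = 0 -> (n <= m)%N ->
  eqX n (qpoch a q m) (qpoch_inf a q).
Proof.
move=> q0 nm k kn; have [N aqN] := qpoch_inf_cvg a q0 k.
rewrite -(aqN (maxn N n)) ?leq_maxl //.
by rewrite (qpoch_eqX a q0 nm kn) (qpoch_eqX a q0 (leq_maxr N n) kn).
Qed.

Lemma qpoch_coef0 a q m : fps_coef a 0 = 0 -> fps_coef (qpoch a q m) 0 = 1.
Proof.
move=> a0; elim: m => [|m IHm]; first by rewrite /qpoch big_ord0.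
rewrite qpochS fps_coefM big_ord1 IHm mul1r fps_coefD fps_coefN fps_coefM.
by rewrite big_ord1 a0 mul0r subr0.
Qed.

Lemma qpoch_unit a q m : fps_coef a 0 = 0 -> qpoch a q m \is a GRing.unit.
Proof. by move=> a0; apply: fps_unit_coef0; rewrite qpoch_coef0. Qed.

Lemma qpoch_inf_unit a q : fps_coef a 0 = 0 -> fps_coef q 0 = 0 ->
  qpoch_inf a q \is a GRing.unit.
Proof.
move=> a0 q0; apply: fps_unit_coef0.
by rewrite -(@qpoch_inf_eqX 1 a q 1 q0) ?qpoch_coef0.
Qed.

Lemma qpoch_inf_even a q : fps_coef q 0 = 0 ->
  qpoch_inf a q = qpoch_inf a (q ^+ 2) * qpoch_inf (a * q) (q ^+ 2).
Proof.
move=> q0; have q20 : fps_coef (q ^+ 2) 0 = 0 by apply: fps_coefXn_lt.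
apply: eqX_eq => n.
apply: (@eqX_trans _ (qpoch a q n.*2)).
  by apply/eqX_sym/qpoch_inf_eqX => //; lia.
by rewrite qpoch_even; apply: eqX_mul; apply: qpoch_inf_eqX.
Qed.

Lemma qpoch_inf_sqr a q : fps_coef q 0 = 0 ->
  qpoch_inf a q * qpoch_inf (- a) q = qpoch_inf (a ^+ 2) (q ^+ 2).
Proof.
move=> q0; have q20 : fps_coef (q ^+ 2) 0 = 0 by apply: fps_coefXn_lt.
apply: eqX_eq => n; apply: (@eqX_trans _ (qpoch (a ^+ 2) (q ^+ 2) n)); last first.
  exact: qpoch_inf_eqX.
by rewrite -qpoch_sqr; apply: eqX_sym; apply: eqX_mul; apply: qpoch_inf_eqX.
Qed.

(** The central Gaussian binomial tends to 1 / (q;q)_oo at a fixed distance from the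
middle. *)
Lemma cbin_eqX n q N r : fps_coef q 0 = 0 -> (n + r <= N)%N ->
  eqX n (cbin q N r * qpoch_inf q q) 1.
Proof.
move=> q0 nrN; have rN : (r <= N)%N by lia.
pose u := qpoch q q (N - r) * qpoch q q (N + r).
have uU : u \is a GRing.unit by rewrite unitrM !qpoch_unit.
have -> : cbin q N r = qpoch q q N.*2 / u by rewrite -(cbinE q rN) mulrK.
rewrite mulrAC; apply: eqX_divr1 => //; rewrite mulrC; apply: eqX_mul.
  by apply/eqX_sym/qpoch_inf_eqX => //; lia.
apply: (@eqX_trans _ (qpoch_inf q q)); first by apply: qpoch_inf_eqX => //; lia.
by apply/eqX_sym/qpoch_inf_eqX => //; lia.
Qed.

Lemma theta_term_eqX n z y q s :
  fps_coef z 0 = 0 -> fps_coef y 0 = 0 -> (0 < n <= s)%N ->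
  eqX n (theta_term z y q s) 0.
Proof.
move=> z0 y0; case: s => [|s] /andP[n0 ns]; first by lia.
rewrite /theta_term -(mulr0 ((-1) ^+ s.+1 * q ^+ 'C(s.+1, 2))).
by apply: eqX_mull; rewrite -(addr0 0); apply: eqX_add; apply: eqX_exp0.
Qed.

Lemma sum_ord_eqX n N (F : nat -> fps R) : (n <= N)%N ->
  (forall i, (n <= i)%N -> eqX n (F i) 0) ->
  eqX n (\sum_(i < N) F i) (\sum_(i < n) F i).
Proof.
move=> nN F0; rewrite -(subnKC nN) big_split_ord /= -[X in eqX _ _ X]addr0.
by apply: eqX_add => //; apply: eqX_sum0 => i _; apply: F0; apply: leq_addr.
Qed.

Lemma jacobi_triple_eqX n z y q :
  z * y = q -> fps_coef z 0 = 0 -> fps_coef y 0 = 0 -> (0 < n)%N ->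
  eqX n (\sum_(s < n) theta_term z y q s)
    (qpoch_inf z q * qpoch_inf y q * qpoch_inf q q).
Proof.
move=> zy z0 y0 n0.
have q0 : fps_coef q 0 = 0 by rewrite -zy fps_coefM big_ord1 z0 mul0r.
apply: (@eqX_trans _ (qpoch z q n.*2 * qpoch y q n.*2 * qpoch_inf q q)); last first.
  by apply: eqX_mulr; apply: eqX_mul; apply: qpoch_inf_eqX => //; lia.
rewrite -finite_jacobi_triple // big_distrl /=; apply: eqX_sym.
apply: (eqX_trans (@sum_ord_eqX n _ (fun s =>
  theta_term z y q s * cbin q n.*2 s * qpoch_inf q q) _ _)).
- by lia.
- move=> s ns; rewrite -mulrA -(mul0r (cbin q n.*2 s * qpoch_inf q q)).
  by apply: eqX_mulr; apply: theta_term_eqX; rewrite ?n0.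
apply: eqX_sum => -[s /= sn] _; rewrite -mulrA -[X in eqX _ _ X]mulr1.
by apply: eqX_mull; apply: cbin_eqX => //; lia.
Qed.

End Congruence.

(** * The double series *)

Section DoubleSum.
Variable R : comUnitRingType.
Implicit Types (k n m N r L : nat).

Local Notation q := (fpsX : fps R).
Local Notation p := ((fpsX : fps R) ^+ 2).

Definition inner_sum L : fps R :=
  \sum_(r < L.+1) p ^+ (r ^ 2) * (qpoch p p r * qpoch p (p ^+ 2) r)^-1 /
    qpoch p p (L - r).

(** Stated for arbitrary series so that the last step of [partial_sums_eqX] does not
compare the infinite products with each other. *)
Lemma eqX_assemble n (S T X B C D : fps R) :
  eqX n T X -> eqX n (S * D) (C * T) -> eqX n (S * (B * D)) (X * (B * C)).
Proof.
move=> TX ST; rewrite mulrCA [X in eqX _ _ X]mulrCA; apply: eqX_mull.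
by apply: (eqX_trans ST); rewrite [X in eqX _ _ X]mulrC; apply: eqX_mull.
Qed.

(** [finite_identity] at N = 3n is multiplied by (p;p)_N (p;p)_oo. Modulo X^n only
the terms with L < n and r < n survive, and the factors that depend on N reach
their limits: N - L and N - 2r are at least n. *)
Lemma partial_sums_eqX n : (0 < n)%N ->
  eqX n (\sum_(L < n) q ^+ (L ^ 2) * qpoch (- q) p L * inner_sum L)
    (qpoch_inf (q ^+ 16) (q ^+ 36) * qpoch_inf (q ^+ 20) (q ^+ 36) *
     qpoch_inf (q ^+ 36) (q ^+ 36) * qpoch_inf (q ^+ 2) (q ^+ 4) /
     qpoch_inf q q).
Proof.
move=> n0; set S := \sum_(L < n) _.
have q0 : fps_coef q 0 = 0 by [].
have p0 : fps_coef p 0 = 0 by apply: coef0X.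
have pU m : qpoch p p m \is a GRing.unit by apply: qpoch_unit.
pose T := \sum_(s < n) theta_term (q ^+ 16) (q ^+ 20) (q ^+ 36) s.
pose N := (3 * n)%N; pose Pinf := qpoch_inf p p.
have sumE : eqX n (S * Pinf) (qpoch_inf (- q) p * T).
  apply: (@eqX_trans _ _ (qpoch p p N * Pinf *
    \sum_(L < N.+1) q ^+ (L ^ 2) * qpoch (- q) p L * inner_sum L / qpoch p p (N - L))).
    rewrite [X in eqX _ _ X]mulrAC; apply: eqX_mulr; rewrite big_distrr /=.
    apply: eqX_sym; pose G L := qpoch p p N *
      (q ^+ (L ^ 2) * qpoch (- q) p L * inner_sum L / qpoch p p (N - L)).
    apply: (@eqX_trans _ _ (\sum_(L < n) G L)).
      apply: (@sum_ord_eqX _ n N.+1 G) => [|L nL]; first by lia.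
      rewrite /G -!mulrA mulrCA -[X in eqX _ _ X](mul0r (qpoch p p N *
        (qpoch (- q) p L * (inner_sum L / qpoch p p (N - L))))).
      by apply: eqX_mulr; apply: eqX_exp0 => //; apply: (leq_trans nL); nia.
    apply: eqX_sum => -[L /= Ln] _; rewrite /G mulrCA.
    rewrite -[X in eqX _ _ X]mulr1; apply: eqX_mull.
    apply: eqX_divr1 => //; apply: (@eqX_trans _ _ Pinf).
      by apply: qpoch_inf_eqX => //; lia.
    by apply/eqX_sym/qpoch_inf_eqX => //; lia.
  rewrite (finite_identity pU N erefl) mulrCA; apply: eqX_mul.
    by apply: qpoch_inf_eqX => //; lia.
  rewrite mulrA mulrAC -mulrA mulrACA -[X in eqX _ _ X]mul1r; apply: eqX_mul.
    apply: eqX_divr1 => //; apply: (@eqX_trans _ _ Pinf).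
      by apply: qpoch_inf_eqX => //; lia.
    by apply/eqX_sym/qpoch_inf_eqX => //; lia.
  rewrite big_distrr /=; pose G r := Pinf *
    (theta_term (q ^+ 16) (q ^+ 20) (q ^+ 36) r * cbin p N r.*2).
  apply: (@eqX_trans _ _ (\sum_(r < n) G r)).
    apply: (@sum_ord_eqX _ n N.+1 G) => [|r nr]; first by lia.
    rewrite /G mulrCA -[X in eqX _ _ X](mul0r (Pinf * cbin p N r.*2)).
    by apply: eqX_mulr; apply: theta_term_eqX; rewrite ?coef0X ?n0.
  apply: eqX_sum => -[r /= rn] _; rewrite /G mulrCA -[X in eqX _ _ X]mulr1.
  by apply: eqX_mull; rewrite mulrC; apply: cbin_eqX => //; lia.
have thetaE : eqX n T (qpoch_inf (q ^+ 16) (q ^+ 36) *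
    qpoch_inf (q ^+ 20) (q ^+ 36) * qpoch_inf (q ^+ 36) (q ^+ 36)).
  have zy : q ^+ 16 * q ^+ 20 = q ^+ 36 by rewrite -exprD.
  exact: (jacobi_triple_eqX zy (coef0X R (c := 16) isT) (coef0X R (c := 20) isT) n0).
have qU : qpoch_inf q q \is a GRing.unit by apply: qpoch_inf_unit.
rewrite -[S](mulrK qU); apply: eqX_mulr.
have -> : qpoch_inf q q = qpoch_inf q p * Pinf.
  by rewrite qpoch_inf_even // -expr2.
have -> : q ^+ 4 = p ^+ 2 by rewrite -exprM.
rewrite -(qpoch_inf_sqr q p0).
exact: eqX_assemble thetaE sumE.
Qed.

Definition summand (nr : nat * nat) : fps R :=
  let n := nr.1 in let r := nr.2 in
  q ^+ (n ^ 2 + 2 * n * r + 3 * r ^ 2) * qpoch (- q) (q ^+ 2) (n + r) /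
  (qpoch (q ^+ 2) (q ^+ 2) n * qpoch (q ^+ 2) (q ^+ 2) r *
   qpoch (q ^+ 2) (q ^+ 4) r).

(** The pairs (n', r) with n' + r < n, listed by L = n' + r: the terms outside
are divisible by X^n. *)
Definition triangle n : seq (nat * nat) :=
  [seq ((L - r)%N, r) | L <- iota 0 n, r <- iota 0 L.+1].

Lemma mem_triangle n nr : (nr \in triangle n) = (nr.1 + nr.2 < n)%N.
Proof.
apply/allpairsPdep/idP => [[L [r [Ln rL ->]]]|nrn].
  by move: Ln rL; rewrite !mem_iota /=; lia.
exists (nr.1 + nr.2)%N, nr.2; rewrite !mem_iota addnK; split; try lia.
by case: nr nrn.
Qed.

Lemma triangle_uniq n : uniq (triangle n).
Proof.
apply: allpairs_uniq_dep => [|L _|]; try exact: iota_uniq.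
move=> [L r] [L' r'] /allpairsPdep[L1 [r1 [_ rL1 E1]]].
move=> /allpairsPdep[L2 [r2 [_ rL2 E2]]].
case: E1 E2 rL1 rL2 => -> -> [-> ->]; rewrite !mem_iota /= => r1L r2L [E Er].
by have -> : L1 = L2 by [lia]; rewrite Er.
Qed.

Lemma square_completion (a r : nat) :
  (a ^ 2 + 2 * a * r + 3 * r ^ 2 = (a + r) ^ 2 + 2 * r ^ 2)%N.
Proof. lia. Qed.

Lemma sum_triangle n : \sum_(nr <- triangle n) summand nr =
  \sum_(L < n) q ^+ (L ^ 2) * qpoch (- q) p L * inner_sum L.
Proof.
rewrite big_allpairs_dep -(big_mkord xpredT (fun L =>
  q ^+ (L ^ 2) * qpoch (- q) p L * inner_sum L)) /index_iota subn0.
apply: eq_bigr => L _; rewrite /inner_sum big_distrr [RHS]/=.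
rewrite -(big_mkord xpredT (fun r => q ^+ (L ^ 2) * qpoch (- q) p L *
  (p ^+ (r ^ 2) * (qpoch p p r * qpoch p (p ^+ 2) r)^-1 / qpoch p p (L - r)))).
rewrite /index_iota subn0 big_seq [RHS]big_seq; apply: eq_bigr => r.
rewrite mem_iota [_ && _]/= ltnS => rL; rewrite /summand [in LHS]/= subnK //.
have -> : ((L - r) ^ 2 + 2 * (L - r) * r + 3 * r ^ 2 = L ^ 2 + 2 * r ^ 2)%N.
  by rewrite square_completion subnK.
have -> : p ^+ 2 = q ^+ 4 by rewrite -exprM.
rewrite (exprD q) (exprM q).
have p0 : fps_coef p 0 = 0 by apply: coef0X.
have u0 : qpoch p p (L - r) \is a GRing.unit by apply: qpoch_unit.
have u1 : qpoch p p r \is a GRing.unit by apply: qpoch_unit.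
have u2 : qpoch p (q ^+ 4) r \is a GRing.unit by apply: qpoch_unit.
move: (qpoch p p (L - r)) (qpoch p p r) (qpoch p (q ^+ 4) r) u0 u1 u2.
move=> a b c aU bU cU; rewrite -[a * b * c]mulrA invrM ?unitrM ?bU //.
move: (q ^+ _) (p ^+ _) (qpoch _ _ _) (b * c)^-1 => x y z w.
by rewrite -!mulrA; congr (_ * _); rewrite mulrCA.
Qed.

Lemma summand_eqX0 n nr : (n <= nr.1 + nr.2)%N -> eqX n (summand nr) 0.
Proof.
case: nr => a r /= nar; rewrite /summand /= -!mulrA.
set g := _ / _; rewrite -(mul0r g); apply: eqX_mulr.
by apply: eqX_exp0 => //; nia.
Qed.

Lemma sum_summand_eqX n (B : seq (nat * nat)) :
  uniq B -> {subset triangle n <= B} ->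
  eqX n (\sum_(nr <- B) summand nr) (\sum_(nr <- triangle n) summand nr).
Proof.
move=> uB sB; rewrite (bigID (fun nr => nr \in triangle n)) /=.
rewrite -[X in eqX _ _ X]addr0; apply: eqX_add; last first.
  apply: eqX_sum0 => nr; rewrite mem_triangle -leqNgt; exact: summand_eqX0.
rewrite -big_filter (perm_big (triangle n)) //; apply: uniq_perm.
- exact: filter_uniq.
- exact: triangle_uniq.
by move=> nr; rewrite mem_filter andb_idr //; apply: sB.
Qed.

End DoubleSum.

Theorem mainTheorem5 (R : comUnitRingType) :
  let q : fps R := fpsX in
  fps_has_sum
    (fun nr : nat * nat =>
       let n := nr.1 in let r := nr.2 in
       q ^+ (n ^ 2 + 2 * n * r + 3 * r ^ 2) * qpoch (- q) (q ^+ 2) (n + r) /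
       (qpoch (q ^+ 2) (q ^+ 2) n * qpoch (q ^+ 2) (q ^+ 2) r *
        qpoch (q ^+ 2) (q ^+ 4) r))
    (qpoch_inf (q ^+ 16) (q ^+ 36) * qpoch_inf (q ^+ 20) (q ^+ 36) *
     qpoch_inf (q ^+ 36) (q ^+ 36) * qpoch_inf (q ^+ 2) (q ^+ 4) /
     qpoch_inf q q).
Proof.
move=> q k; exists (triangle k.+1) => B uB sB.
rewrite -(partial_sums_eqX R (ltn0Sn k) (ltnSn k)) -sum_triangle.
exact: (sum_summand_eqX R uB sB (ltnSn k)).
Qed.
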